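(* Let $\mathcal S$ be a control semigroup. If $1\to K\to G\to H\to1$ is an exact sequence of groups such that $G$ is finitely generated, then $$asdim_{\mathcal S}(G,d_G)\le asdim_{\mathcal S}(K,d_G|_K)+asdim_{\mathcal S}(H,d_H)$$ for any word metrics $d_G$ on $G$ and $d_H$ on $H$.
   Context: $\mathbb R_+=[0,\infty)$. A property $P(s)$ of positive reals holds in a neighborhood of $\infty$ if there is $s_0$ such that it holds for all $s\ge s_0$. An asymptotic (large scale) dim-control function is an increasing continuous $f:\mathbb R_+\to\mathbb R_+$ with $f(x)\ge x$ in a neighborhood of $\infty$ and $\lim_{x\to\infty}f(x)=\infty$; it is asymptotically linear if it equals some linear function in a neighborhood of $\infty$. A (large scale) control semigroup is a set $\mathcal S$ of asymptotic dim-control functions containing every asymptotically linear dim-control function and closed under composition. A family of subsets of a metric space is $s$-disjoint if $d(U,V)>s$ for any two distinct members $U,V$, and $C$-bounded if every member has diameter $\le C$. $asdim_{\mathcal S}X\le n$ means there is $f\in\mathcal S$ such that for every $s$ in some neighborhood of $\infty$ there is a cover $\mathcal U=\bigcup_{i=1}^{n+1}\mathcal U_i$ of $X$ with each $\mathcal U_i$ $s$-disjoint and $f(s)$-bounded; $asdim_{\mathcal S}X$ is the least such $n$ ($\infty$ if none). Word metrics are taken with respect to finite generating sets; $d_G|_K$ is the restriction of $d_G$ to (the image of) $K$ in $G$. *)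

(* Defs.v *)
From HB Require Import structures.
From mathcomp Require Import all_boot all_order all_algebra.
From mathcomp Require Import all_classical all_reals all_analysis.

Set Implicit Arguments.
Unset Strict Implicit.
Unset Printing Implicit Defensive.

Import Order.TTheory GRing.Theory Num.Theory.
Import numFieldNormedType.Exports.

Local Open Scope classical_set_scope.
Local Open Scope ring_scope.

Section ControlFunctions.
Variable R : realType.
Implicit Types (f g : R -> R) (S : set (R -> R)).

(* A function from [0, +oo[ to itself is represented by a function R -> R
   preserving [0, +oo[; its values on negative reals are unconstrained and never
   used below. *)
Definition dim_control f : Prop :=
  [/\ forall x, 0 <= x -> 0 <= f x,
      {in `[0, +oo[ &, {homo f : x y / x < y}},
      {within `[0, +oo[, continuous f},
      \forall x \near +oo, x <= f x
    & f x @[x --> +oo] --> +oo].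

(* Linear means x |-> a * x. Asking S to contain only these, rather than all
   x |-> a * x + b, makes being a control semigroup a weaker condition. *)
Definition asymptotically_linear f : Prop :=
  exists a : R, \forall x \near +oo, f x = a * x.

Definition control_semigroup S : Prop :=
  [/\ forall f, S f -> dim_control f,
      forall f, dim_control f -> asymptotically_linear f -> S f
    & forall f g, S f -> S g -> S (f \o g)].

End ControlFunctions.

Section AsymptoticDimension.
Variables (R : realType) (X : Type) (d : X -> X -> R).
Implicit Types (U V : set X) (F : set (set X)) (S : set (R -> R)).

Definition setdist U V : \bar R :=
  ereal_inf [set (d u v)%:E | u in U & v in V].

Definition diameter U : \bar R :=
  ereal_sup [set (d u v)%:E | u in U & v in U].

Definition disjoint_family (s : R) F : Prop :=
  forall U V, F U -> F V -> U <> V -> (s%:E < setdist U V)%E.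

Definition bounded_family (C : R) F : Prop :=
  forall U, F U -> (diameter U <= C%:E)%E.

Definition asdim_le S (n : nat) : Prop :=
  exists2 f, S f & \forall s \near +oo,
    exists F : 'I_n.+1 -> set (set X),
      (forall x, exists i, exists2 U, F i U & U x) /\
      (forall i, disjoint_family s (F i) /\ bounded_family (f s) (F i)).

(* The infimum of the empty set is +oo, and a nonempty set of naturals attains
   its infimum. *)
Definition asdim S : \bar R :=
  ereal_inf [set (n%:R)%:E | n in asdim_le S].

End AsymptoticDimension.

Section WordMetric.
Variable G : groupType.
Implicit Types (A : seq G) (x y g : G).

Definition word_of_length A g (n : nat) : Prop :=
  exists w : seq G,
    [/\ size w = n,
        forall x, x \in w -> x \in A \/ (x^-1)%g \in A
      & g = (\prod_(x <- w) x)%g].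

Definition generates A : Prop := forall g, exists n, word_of_length A g n.

Definition finitely_generated : Prop := exists A, generates A.

Lemma word_lengthP A : generates A ->
  forall g, exists n, `[< word_of_length A g n >].
Proof. by move=> hA g; have [n hn] := hA g; exists n; apply/asboolP. Qed.

Definition word_length A (hA : generates A) g : nat := ex_minn (word_lengthP hA g).

Definition word_metric (R : realType) A (hA : generates A) x y : R :=
  (word_length hA (x^-1 * y)%g)%:R.

Definition is_word_metric (R : realType) (d : G -> G -> R) : Prop :=
  exists A, exists hA : generates A, d = word_metric R hA.

End WordMetric.

Definition short_exact (K G H : groupType)
    (i : {multiplicative K -> G}) (p : {multiplicative G -> H}) : Prop :=
  [/\ injective i, range i = [set g | p g = 1%g] & range p = setT].

(* Main.v *)
(* Covers are sharpened by Kolmogorov's trick: n + 1 layers covering a space, at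
   some scale, can be replaced by m > n layers such that every point lies in at
   least m - n of them, at the cost of a linear change of scale.  With
   m = k + n + 1 the layers of H contain every point at least k + 1 times.  If G
   carries m layers covering every point at least n + 1 times whose traces on
   preimages of R-balls of H are bounded at scale s, then intersecting the j-th
   layer of G with the preimage of the j-th layer of H, for all j, still covers G.

   Fibres of G -> H are translates of K, so preimages of balls are covered by k + 1
   thickened layers of K, but these depend on the ball.  They are made global by
   decomposing H into n + 1 families of uniformly bounded pieces so far apart that
   an R-ball meets at most one piece of each family, and by using over the n + 1
   families covers of the fibres at nested scales, each scale exceeding the bound
   of the previous one.  Only finitely many compositions of control functions of
   the semigroup occur. *)

Require Import Defs.
From HB Require Import structures.
From mathcomp Require Import all_boot all_order all_algebra.
From mathcomp Require Import all_classical all_reals all_analysis.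
From mathcomp Require Import lra.

Set Implicit Arguments.
Unset Strict Implicit.
Unset Printing Implicit Defensive.

Import Order.TTheory GRing.Theory Num.Theory.
Import numFieldNormedType.Exports.

Local Open Scope classical_set_scope.
Local Open Scope ring_scope.

(** * Counting the layers that contain a point *)

Section Multiplicity.
Variables (X : Type) (m : nat).
Implicit Types P Q : 'I_m -> set X.

Definition multiplicity P (x : X) : nat := (\sum_(j < m) `[< P j x >])%N.

Lemma multiplicity_le P Q x y :
  (forall j, P j x -> Q j y) -> (multiplicity P x <= multiplicity Q y)%N.
Proof.
move=> PQ; apply: leq_sum => j _.
by case: (asboolP (P j x)) => // /PQ /asboolT ->.
Qed.

(** The indices of the layers [P] at [x] lie among those of [Q] at [y] and are at least as many, so
    the two sets of indices coincide. *)
Lemma multiplicity_saturated P Q x y :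
  (forall j, P j x -> Q j y) -> (multiplicity Q y <= multiplicity P x)%N ->
  forall j, Q j y -> P j x.
Proof.
move=> PQ leQP j Qj; apply: contrapT => nPj; move: leQP; apply/negP.
rewrite -ltnNge /multiplicity (bigD1 j) // [ltnRHS](bigD1 j) //=.
rewrite asboolF // asboolT // add0n ltnS; apply: leq_sum => l _.
by case: (asboolP (P l x)) => // /PQ /asboolT ->.
Qed.

Lemma multiplicity_pos_ex P x : (0 < multiplicity P x)%N -> exists j, P j x.
Proof.
move=> P_gt0; apply: contrapT => /forallNP nP; move: P_gt0.
by rewrite /multiplicity big1 // => j _; rewrite asboolF.
Qed.

Lemma multiplicity_gt0 P x j : P j x -> (0 < multiplicity P x)%N.
Proof. by move=> Pj; rewrite /multiplicity (bigD1 j) //= asboolT. Qed.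

End Multiplicity.

(** Pigeonhole: two disjoint sets of indices below [m] have at most [m] elements together. *)
Lemma multiplicity_meet (X Y : Type) m (P : 'I_m -> set X)
    (Q : 'I_m -> set Y) x (y : Y) :
  (m < multiplicity P x + multiplicity Q y)%N -> exists2 j, P j x & Q j y.
Proof.
move=> m_lt; apply: contrapT => nPQ; move: m_lt; apply/negP; rewrite -leqNgt.
rewrite /multiplicity -big_split /= -[leqRHS]card_ord -sum1_card.
apply: leq_sum => j _; case: asboolP => [Pj|_]; last by case: asboolP.
by rewrite asboolF // => Qj; apply: nPQ; exists j.
Qed.


(** * Chains and the components of a set at a given scale *)

Section Chains.
Variables (R : realType) (X : Type) (d : X -> X -> R).
Implicit Types (s C : R) (P Q : set X) (x y z : X).

Definition pseudometric : Prop :=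
  [/\ forall x, d x x = 0, forall x y, d x y = d y x
    & forall x y z, d x z <= d x y + d y z].

Inductive chain s P x : X -> Prop :=
| chain_nil : P x -> chain s P x x
| chain_rcons y z : chain s P x y -> P z -> d y z <= s -> chain s P x z.

(* The s-components of P have diameter at most C.  Up to the choice of s, such
   sets are the unions of s-disjoint C-bounded families. *)
Definition chain_bounded s C P : Prop := forall x y, chain s P x y -> d x y <= C.

Definition layered_cover s C (m q : nat) : Prop :=
  exists P : 'I_m -> set X,
    (forall j, chain_bounded s C (P j)) /\
    (forall x, (q <= multiplicity P x)%N).

Lemma chain_mem_l s P x y : chain s P x y -> P x.
Proof. by elim. Qed.

Lemma chain_mem_r s P x y : chain s P x y -> P y.
Proof. by case. Qed.

Lemma chain_trans s P x y z : chain s P x y -> chain s P y z -> chain s P x z.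
Proof.
by move=> xy; elim=> // u v _ xu Pv uv; exact: chain_rcons uv.
Qed.

Lemma chain_sym s P x y : pseudometric -> chain s P x y -> chain s P y x.
Proof.
move=> [_ dC _]; elim=> [|{}y z xy yx Pz yz]; first exact: chain_nil.
apply: chain_trans yx; apply: (chain_rcons (chain_nil _ Pz)).
  exact: chain_mem_r xy.
by rewrite dC.
Qed.

Lemma chain_sub s s' P P' x y :
  s <= s' -> P `<=` P' -> chain s P x y -> chain s' P' x y.
Proof.
move=> ss PP; elim=> [/PP|{}y z _ xy /PP Pz yz]; first exact: chain_nil.
exact: chain_rcons xy Pz (le_trans yz ss).
Qed.

Lemma chain_bounded_sub s s' C C' P P' :
  s' <= s -> C <= C' -> P' `<=` P ->
  chain_bounded s C P -> chain_bounded s' C' P'.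
Proof.
by move=> ss CC PP PC x y xy; apply: le_trans CC; exact/PC/(chain_sub ss PP xy).
Qed.

Lemma layered_cover_le s s' C C' m q :
  s' <= s -> C <= C' -> layered_cover s C m q -> layered_cover s' C' m q.
Proof.
move=> ss CC [P [PC Pq]]; exists P; split=> // j.
exact: chain_bounded_sub (PC j).
Qed.

(** [c] chooses from the component as a set, hence is constant on components; [x0] is the default
    for the empty set. *)
Lemma chain_representative s P (x0 : X) : pseudometric ->
  exists c : X -> X, (forall x, P x -> chain s P x (c x)) /\
    (forall x y, chain s P x y -> c x = c y).
Proof.
move=> dX; have /choice[r Hr] : forall A : set X, exists z, A !=set0 -> A z.
  move=> A; case: (pselect (A !=set0)) => [[z Az]|nA]; first by exists z.
  by exists x0.
exists (fun x => r (chain s P x)); split=> [x Px|x y xy].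
  by apply: Hr; exists x; exact: chain_nil.
congr r; apply/seteqP; split=> z; apply: chain_trans => //.
exact: chain_sym.
Qed.

End Chains.

Lemma chain_map (R : realType) (X Y : Type) (d : X -> X -> R) (e : Y -> Y -> R)
    (h : X -> Y) s t (P : set X) (Q : set Y) x y :
  (forall u, P u -> Q (h u)) ->
  (forall u v, d u v <= s -> e (h u) (h v) <= t) ->
  chain d s P x y -> chain e t Q (h x) (h y).
Proof.
move=> PQ de; elim=> [/PQ|{}y z _ xy /PQ Qz /de]; first exact: chain_nil.
exact: chain_rcons xy Qz.
Qed.

(** Moving each point of an [s]-chain by at most [r] into the image of [Q] gives an
    [(s + 2 * r)]-chain. *)
Lemma chain_bounded_thicken (R : realType) (X Y : Type) (d : X -> X -> R)
    (e : Y -> Y -> R) (h : Y -> X) s r C (Q : set Y) :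
  pseudometric d -> (forall u v, d (h u) (h v) = e u v) ->
  chain_bounded e (s + 2 * r) C Q ->
  chain_bounded d s (C + 2 * r) [set x | exists2 u, Q u & d x (h u) <= r].
Proof.
move=> [_ dC dT] he QC x y xy; have [u Qu xu] := chain_mem_l xy.
suff [v [Qv yv uv]] : exists v, [/\ Q v, d y (h v) <= r &
    chain e (s + 2 * r) Q u v].
  have := QC _ _ uv; rewrite -he.
  have := dT x (h u) y; have := dT (h u) (h v) y; rewrite (dC (h v) y); lra.
elim: xy => [_|{}y z _ [v [Qv yv uv]] [w Qw zw] yz].
  by exists u; split=> //; exact: chain_nil.
exists w; split=> //; apply: (chain_rcons uv Qw); rewrite -he.
have := dT (h v) y (h w); have := dT y z (h w); rewrite (dC (h v) y); lra.
Qed.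

(** Between visits to [Q] an [s]-chain runs inside one component of [P], so the visits form a
    [(C + 2 * s)]-chain; the two ends outside [Q] cost at most [C + s] each. *)
Lemma chain_bounded_setU (R : realType) (X : Type) (d : X -> X -> R) s C D E
    (P Q : set X) :
  pseudometric d -> 0 <= s -> 0 <= C -> C <= E -> D + 2 * (C + s) <= E ->
  chain_bounded d s C P -> chain_bounded d (C + 2 * s) D Q ->
  chain_bounded d s E (P `|` Q).
Proof.
move=> [d0 dC dT] s0 C0 CE DE PC QD x y xy.
have PC' u v : chain d s P u v -> d u v <= C by exact: PC.
(* [a] and [b] are the first and last points counted as visits to [Q]; [c] is the first point of the
   chain after [b]. *)
suff [/PC'|[a [b [ab xa]]]] : chain d s P x y \/
  exists a b, [/\ chain d (C + 2 * s) Q a b, d x a <= C + s &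
     (b = y \/ exists c, [/\ chain d s P c y & d b c <= s])].
- by move=> ?; exact: le_trans CE.
- move=> [<-|[c [/PC' cy bc]]].
    by have := QD _ _ ab; have := dT x a b; lra.
  have := QD _ _ ab; have := dT x a y; have := dT a b y; have := dT b c y; lra.
elim: xy => [[Px|Qx]|{}y z _].
- by left; exact: chain_nil.
- by right; exists x, x; split; [exact: chain_nil | rewrite d0; lra | left].
move=> [xy|[a [b [ab xa yb]]]] [Pz|Qz] yz.
- by left; exact: chain_rcons yz.
- right; exists z, z; split; [exact: chain_nil | | by left].
  by have := PC' _ _ xy; have := dT x y z; lra.
- right; exists a, b; split=> //; right; case: yb => [->|[c [cy bc]]].
    by exists z; split=> //; exact: chain_nil.
  by exists c; split=> //; exact: chain_rcons yz.
- right; exists a, z; split; [|exact: xa|by left].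
  apply: (chain_rcons ab Qz); case: yb => [->|[c [/PC' cy bc]]]; first lra.
  have := dT b y z; have := dT b c y; lra.
Qed.

(** * Covers bounded over balls of the base: Kolmogorov's trick, intersection and gluing *)

Section FibreCovers.
Variables (R : realType) (X Y : Type) (d : X -> X -> R) (e : Y -> Y -> R).
Variables (p : X -> Y) (L : R).
Hypotheses (dX : pseudometric d) (eY : pseudometric e).
Hypotheses (L0 : 0 <= L) (pL : forall x x', e (p x) (p x') <= L * d x x').

Definition fibre_cover (s r C : R) (m q : nat) : Prop :=
  exists P : 'I_m -> set X,
    (forall j y, chain_bounded d s C (P j `&` [set x | e (p x) y <= r])) /\
    (forall x, (q <= multiplicity P x)%N).

Lemma fibre_cover_le s s' r r' C C' m q : s' <= s -> r' <= r -> C <= C' ->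
  fibre_cover s r C m q -> fibre_cover s' r' C' m q.
Proof.
move=> ss rr CC [P [PC Pq]]; exists P; split=> // j y.
apply: chain_bounded_sub (PC j y) => // x [Px /= xy]; split=> //=.
exact: le_trans rr.
Qed.

(* Kolmogorov's trick: thicken every layer, and collect in one additional layer
   the points whose multiplicity does not increase.  On an s-chain of those
   the set of original layers containing the point is constant. *)
Lemma fibre_cover_add s r C m q : 0 <= s -> (0 < q)%N ->
  fibre_cover (3 * s) (r + L * s) C m q ->
  fibre_cover s r (C + 2 * s) m.+1 q.+1.
Proof.
move=> s0 q0 [P [PC Pq]]; have [d0 dC _] := dX; have [_ eC eT] := eY.
pose T j := [set x | exists2 u, P j u & d x u <= s].
have PT j x : P j x -> T j x by move=> Px; exists x; rewrite ?d0.
pose N := [set x | (multiplicity T x <= q)%N].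
exists (fun j => oapp T N (unlift ord_max j)); split=> [j y|x].
  case: (unlift ord_max j) => [{}j|] /=.
    (* A point within [s] of [x] projects to within [L * s] of [p x], hence the larger radius. *)
    pose PB := P j `&` [set x | e (p x) y <= r + L * s].
    apply: (@chain_bounded_sub _ _ _ s s (C + 2 * s) (C + 2 * s)
      [set x | exists2 u, PB u & d x u <= s]) => //.
      move=> x [[u Pu xu] /= xy]; exists u => //; split=> //=.
      have := eT (p u) (p x) y; have := pL u x; have := ler_wpM2l L0 xu.
      rewrite (dC u x); lra.
    apply: (chain_bounded_thicken (h := id) dX (e := d)) => //.
    by apply: chain_bounded_sub (PC j y) => //; lra.
  move=> x z xz.
  (* Since [0 < q], some original layer contains the start of the chain; the chain never leaves it,
     so its bound [C] applies. *)
  have [l Pl] := multiplicity_pos_ex (leq_trans q0 (Pq x)).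
  apply: (@le_trans _ _ C); last lra; apply: (PC l y).
  apply: (@chain_sub _ _ _ s _ (P l `&` [set x | e (p x) y <= r])).
  - lra.
  - move=> u [Pu /= uy]; split=> //=; apply: le_trans uy _.
    by rewrite lerDl mulr_ge0.
  elim: xz => [[_ xy]|{}z w _ xz [Nw wy] zw]; first exact: chain_nil.
  apply: (chain_rcons xz _ zw); split=> //.
  apply: (@multiplicity_saturated _ _ P T w w).
  - by move=> ?; exact: PT.
  - exact: leq_trans Nw (Pq w).
  - by exists z; [have [] := chain_mem_r xz | rewrite dC].
rewrite /multiplicity big_ord_recr /= unlift_none /=.
under eq_bigr => j _.
  have -> : widen_ord (leqnSn m) j = lift ord_max j
    by apply/val_inj/esym/lift_max.
  rewrite liftK /=; over.
have qT : (q <= multiplicity T x)%N.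
  by apply: leq_trans (Pq x) _; apply: multiplicity_le => j; exact: PT.
rewrite -/(multiplicity T x) /N /=; case: (leqP (multiplicity T x) q) => Tq.
  by rewrite asboolT // addn1 ltnS.
by apply: leq_trans Tq _; rewrite leq_addr.
Qed.

(** Layers are added at scales [3 ^+ i * s] for [i < j], and the increments [2 * 3 ^+ i * s] of the
    bound sum to [(3 ^+ j - 1) * s]. *)
Lemma fibre_cover_iter j s r C m q : 0 <= s -> (0 < q)%N ->
  fibre_cover (3 ^+ j * s) (r + 3 ^+ j * (L * s)) C m q ->
  fibre_cover s r (C + (3 ^+ j - 1) * s) (m + j) (q + j).
Proof.
(* Lowering the coefficient to [3 ^+ j - 1] leaves room in the induction for the [L * s] spent on
   the radius at each step. *)
move=> s0 q0 cov; have {cov} :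
    fibre_cover (3 ^+ j * s) (r + (3 ^+ j - 1) * (L * s)) C m q.
  by apply: fibre_cover_le cov => //; have := mulr_ge0 L0 s0; lra.
elim: j s s0 r => [|j IH] s s0 r.
  by rewrite expr0 mul1r subrr !mul0r !addr0 !addn0.
have Ls0 := mulr_ge0 L0 s0.
rewrite !addnS exprSr => cov.
have s30 : 0 <= 3 * s by lra.
have {}IH := IH (3 * s) s30 (r + L * s).
have /IH {}cov : fibre_cover (3 ^+ j * (3 * s))
    (r + L * s + (3 ^+ j - 1) * (L * (3 * s))) C m q.
  by apply: fibre_cover_le cov => //; lra.
have q0' : (0 < q + j)%N by rewrite ltn_addr.
by apply: fibre_cover_le (fibre_cover_add s0 q0' cov) => //; lra.
Qed.

(* The layers of X containing x and those of Y containing p x are more than m in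
   total, hence share an index. *)
Lemma layered_cover_fibration s r C m q q' :
  fibre_cover s r C m q -> layered_cover e (L * s) r m q' -> (m < q + q')%N ->
  layered_cover d s C m 1.
Proof.
move=> [U [UC Uq]] [V [VD Vq]] mq.
exists (fun j => U j `&` [set x | V j (p x)]); split=> [j x y xy|x].
  apply: (UC j (p x)).
  have [_ eC _] := eY.
  elim: xy => [[Ux /= Vx]|{}y z xy xy' [Uz /= Vz] yz].
    apply: chain_nil; split=> //=; apply: (VD j); exact: chain_nil.
  apply: (chain_rcons xy' _ yz); split=> //=; rewrite eC; apply: (VD j).
  have pstep u v : d u v <= s -> e (p u) (p v) <= L * s.
    by move=> uv; apply: le_trans (pL u v) _; exact: ler_wpM2l.
  apply: (chain_rcons _ Vz (pstep _ _ yz)); apply: (chain_map _ pstep xy).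
  by move=> u [].
have [j Uj Vj] := multiplicity_meet
  (leq_trans mq (leq_add (Uq x) (Vq (p x)))).
by apply: (@multiplicity_gt0 _ _ _ _ j).
Qed.

(* Every r-ball of Y meets at most one t-component of each piece [H i], so that
   over such a ball only one fibre cover per piece is involved; these are merged
   by chain_bounded_setU because each next one is taken at a scale exceeding the
   bound of the previous ones. *)
Lemma fibre_cover_glue (G : R -> R) (s r t T D : R) a k (H : 'I_a -> set Y) :
  0 <= s -> 0 <= T -> 2 * r <= t ->
  (forall i, chain_bounded e t D (H i)) ->
  (forall u, T <= u -> u <= G u) ->
  (forall u y, T <= u -> exists Q : 'I_k -> set X,
     (forall j, exists2 C, chain_bounded d (u + 2 * s) C (Q j) &
       C + 2 * (u + s) <= G u) /\
     (forall x, e (p x) y <= D -> exists j, Q j x)) ->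
  exists U : 'I_k -> set X,
    (forall j y, chain_bounded d s (iter a G T)
       (U j `&` [set x | e (p x) y <= r])) /\
    (forall x i, H i (p x) -> exists j, U j x).
Proof.
move=> s0 T0 rt HD Gu fib; elim: a H HD => [|a IH] H HD.
  exists (fun=> set0); split=> [j y x z xz|x [i i0] //].
  by have [] := chain_mem_l xz.
have [U [UC UH]] := IH (fun i => H (lift ord_max i)) (fun i => HD _).
(* [u] bounds the layers over all pieces but the last, whose fibre covers are now taken at a scale
   beyond [u]. *)
set u := iter a G T in UC.
have Tu : T <= u.
  by rewrite /u; elim: (a) => //= b Tb; exact: le_trans Tb (Gu _ Tb).
have /choice[Q HQ] : forall y, exists Q : 'I_k -> set X,
    (forall j, exists2 C, chain_bounded d (u + 2 * s) C (Q j) &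
       C + 2 * (u + s) <= G u) /\
    (forall x, e (p x) y <= D -> exists j, Q j x).
  by move=> y; exact: fib.
case: (pselect (exists x : X, True)) => [[x0 _]|nX]; last first.
  by exists (fun=> set0); split=> [j y x|x]; case: nX; exists x.
have [c [cH cE]] := chain_representative t (H ord_max) (p x0) eY.
(* Over the last piece each component uses one fibre cover, the one centred at its
   representative. *)
exists (fun j => U j `|` [set x | H ord_max (p x) /\ Q (c (p x)) j x]).
have [_ eC eT] := eY; split=> [j y|x i Hx]; last first.
  case: (unliftP ord_max i) Hx => [i' ->|->] Hx.
    by have [j Uj] := UH _ _ Hx; exists j; left.
  have [j Qj] := (HQ (c (p x))).2 x (HD _ _ _ (cH _ Hx)).
  by exists j; right.
case: (pselect (exists2 x, H ord_max (p x) & e (p x) y <= r)) =>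
    [[x1 Hx1 x1y]|nH].
  have [C QC CG] := (HQ (c (p x1))).1 j.
  have := chain_bounded_setU dX s0 (le_trans T0 Tu) (Gu _ Tu) CG (UC j y) QC.
  apply: chain_bounded_sub => // x [[Ux|[Hx Qx]] xy]; first by left.
  (* [p x1] and [p x] lie in one [r]-ball, so [2 * r <= t] puts them in the same [t]-component. *)
  right; rewrite (cE (p x1) (p x)) //.
  apply: chain_rcons (chain_nil _ _ _) Hx _ => //.
  have := eT (p x1) y (p x); rewrite (eC y (p x)); move: xy => /=; lra.
apply: chain_bounded_sub (UC j y) => //; first by rewrite iterS Gu.
by move=> x [[Ux|[Hx Qx]] xy] //; case: nH; exists x.
Qed.

End FibreCovers.

(** Over a one-point base the condition on fibres is vacuous, so Kolmogorov's trick for plain covers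
    is the case of Lipschitz constant 0. *)
Lemma layered_coverE (R : realType) (X : Type) (d : X -> X -> R) s C m q :
  layered_cover d s C m q <->
  fibre_cover d (fun _ _ : unit => 0) (fun _ : X => tt) s 0 C m q.
Proof.
split=> [] [P [PC Pq]]; exists P; split=> //.
  by move=> j y; apply: chain_bounded_sub (PC j) => // x [].
by move=> j; apply: chain_bounded_sub (PC j tt) => // x Px;
  exact: (conj Px (lexx _)).
Qed.

Lemma layered_cover_iter (R : realType) (X : Type) (d : X -> X -> R) j (s C : R)
    m q :
  pseudometric d -> 0 <= s -> (0 < q)%N ->
  layered_cover d (3 ^+ j * s) C m q ->
  layered_cover d s (C + (3 ^+ j - 1) * s) (m + j) (q + j).
Proof.
move=> dX s0 q0 /layered_coverE cov; apply/layered_coverE.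
apply: (@fibre_cover_iter _ _ _ _ _ _ 0) => //.
  by move=> x x'; rewrite mul0r.
by rewrite mul0r mulr0 addr0.
Qed.

(** * Control functions, layered covers and asymptotic dimension of a fibration *)

Section ControlSemigroup.
Variables (R : realType) (S : set (R -> R)).
Hypothesis SS : control_semigroup S.

Lemma near_pinftyW (P : R -> Prop) : (\forall s \near +oo, P s) ->
  exists2 M, 0 < M & forall s, M <= s -> P s.
Proof.
move=> [M [_ MP]]; exists (Num.max M 0 + 1).
  by rewrite ltr_pwDr // le_max lexx orbT.
move=> s Ms; apply: MP; apply: lt_le_trans Ms.
by rewrite ltr_pwDr // le_max lexx.
Qed.

Lemma scale_in (a : R) : 1 <= a -> S ( *%R a).
Proof.
move=> a1; have a0 : 0 < a by lra.
have [_ + _] := SS; apply; last by exists a; near=> x.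
split=> [x x0|x y _ _ xy||| ].
- by rewrite mulr_ge0 // ltW.
- by rewrite ltr_pM2l.
- by apply: continuous_subspaceT => x; exact: mulrl_continuous.
- near=> x; rewrite ler_peMl //; near: x; exact: nbhs_pinfty_ge.
- by apply: gt0_cvgMry => //; exact: cvg_id.
Unshelve. all: by end_near. Qed.

Lemma comp_in f g : S f -> S g -> S (fun x => f (g x)).
Proof. by move=> Sf Sg; have [_ _] := SS; exact. Qed.

Lemma iter_in f n : S f -> S (iter n f).
Proof.
move=> Sf; elim: n => [|n IH]; last exact: comp_in.
have := @scale_in 1 (lexx _); congr (S _).
by apply/funext => x; rewrite mul1r.
Qed.

Lemma control_ge f : S f -> exists2 M, 0 < M & forall s, M <= s -> s <= f s.
Proof. by move=> Sf; have [/(_ f Sf)[_ _ _ + _]] := SS; move=> /near_pinftyW. Qed.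

(** The union of each disjoint family is one layer; [j] rounds of Kolmogorov's trick, started at
    scale [3 ^+ j * s], raise the multiplicity from 1 to [j.+1]. *)
Lemma asdim_le_layered (X : Type) (d : X -> X -> R) n j :
  pseudometric d -> asdim_le d S n ->
  exists2 f, S f & exists2 M, 0 < M &
    forall s, M <= s -> s <= f s /\ layered_cover d s (f s) (n.+1 + j) j.+1.
Proof.
move=> dX [f Sf /near_pinftyW[M M0 HM]].
have [N N0 HN] := control_ge Sf.
have e1 : 1 <= 3 ^+ j :> R by rewrite exprn_ege1 // ler1n.
(* The factor 2 absorbs the added [(3 ^+ j - 1) * s], which is at most [f (3 ^+ j * s)]. *)
exists (fun s => 2 * f (3 ^+ j * s)).
  by apply: comp_in (@scale_in 2 _) (comp_in Sf (scale_in e1)); lra.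
exists (Num.max M N) => [|s]; first by rewrite lt_max M0.
rewrite ge_max => /andP[Ms Ns]; have s0 : 0 <= s by lra.
have ss : s <= 3 ^+ j * s by rewrite ler_peMl.
have fs := HN _ (le_trans Ns ss); split; first lra.
have [F [Fcov FC]] := HM _ (le_trans Ms ss).
have cov : layered_cover d (3 ^+ j * s) (f (3 ^+ j * s)) n.+1 1.
  exists (fun i => [set x | exists2 U, F i U & U x]);
    split=> [i x y xy|x]; last first.
    by have [i Fi] := Fcov x; exact: (@multiplicity_gt0 _ _ _ _ i).
  have [Fs FB] := FC i.
  have [U FU Ux] := chain_mem_l xy.
  (* Disjointness keeps the chain inside the member where it starts. *)
  suff Uy : U y.
    have := FB _ FU; rewrite /diameter => /(le_trans _) H.
    rewrite -lee_fin; apply: H; apply: ereal_sup_ubound.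
    by exists x => //; exists y.
  elim: xy => // {}y z xy Uy [V FV Vz] yz.
  apply: contrapT => nUz; have UV : U <> V by move=> UV; apply: nUz; rewrite UV.
  have := Fs _ _ FU FV UV; apply/negP; rewrite -leNgt.
  apply: (@le_trans _ _ (d y z)%:E); last by rewrite lee_fin.
  by apply: ereal_inf_lbound; exists y => //; exists z.
have := layered_cover_iter dX s0 (ltn0Sn 0) cov; rewrite add1n.
apply: layered_cover_le => //; lra.
Qed.

(* Passing to the scale 2s makes the distance between components > s, since an
   infimum of numbers > s could equal s. *)
Lemma layered_asdim_le (X : Type) (d : X -> X -> R) f n M :
  pseudometric d -> S f ->
  (forall s, M <= s -> layered_cover d s (f s) n.+1 1) -> asdim_le d S n.
Proof.
move=> dX Sf HM; exists (fun s => f (2 * s)).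
  by apply: comp_in Sf (@scale_in 2 _); lra.
near=> s; have s0 : 0 < s by near: s; exact: nbhs_pinfty_gt.
have [|P [PC P1]] := HM (2 * s).
  suff : M <= s by lra.
  by near: s; exact/nbhs_pinfty_ge/num_real.
exists (fun i => [set chain d (2 * s) (P i) x | x in P i]); split=> [x|i].
  have [i Pi] := multiplicity_pos_ex (P1 x); exists i.
  by exists (chain d (2 * s) (P i) x); [exists x | exact: chain_nil].
split=> [U V [x Px <-] [y Py <-] UV|U [x Px <-]].
  apply: (@lt_le_trans _ _ (2 * s)%:E); first by rewrite lte_fin; lra.
  apply: le_ereal_inf_tmp => _ [u xu [v yv <-]]; rewrite lee_fin leNgt.
  apply/negP => uv; apply: UV.
  have xy : chain d (2 * s) (P i) x y.
    apply: (chain_trans (chain_rcons xu (chain_mem_r yv) (ltW uv))).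
    exact: chain_sym.
  by apply/seteqP; split=> z; apply: chain_trans => //; exact: chain_sym.
apply: ge_ereal_sup => _ [u xu [v xv <-]]; rewrite lee_fin; apply: (PC i).
by apply: chain_trans xv; exact: chain_sym.
Unshelve. all: by end_near. Qed.

(** One [g], independent of [D], controls preimages of [D]-balls at every scale above [M] and
    [mu * D]; this is what lets a fixed composition in [S] bound the final cover. *)
Lemma asdim_le_fibration (X Y : Type) (d : X -> X -> R) (e : Y -> Y -> R)
    (p : X -> Y) (L mu M : R) g n k :
  pseudometric d -> pseudometric e -> 1 <= L -> 0 <= mu ->
  (forall x x', e (p x) (p x') <= L * d x x') ->
  asdim_le e S n -> S g ->
  (forall t D y, M <= t -> mu * D <= t -> exists Q : 'I_k.+1 -> set X,
     (forall j, chain_bounded d t (g t) (Q j)) /\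
     (forall x, e (p x) y <= D -> exists j, Q j x)) ->
  asdim_le d S (n + k).
Proof.
move=> dX eY L1 mu0 pL en Sg fib.
(* [Y] is covered twice: with multiplicity [k.+1] for the final intersection, and by [n.+1] plain
   layers as pieces for the gluing. *)
have [hV ShV [MV MV0 HV]] := asdim_le_layered k eY en.
have [hH ShH [MH MH0 HH]] := asdim_le_layered 0 eY en.
have [Mg Mg0 Hg] := control_ge Sg.
set E : R := 3 ^+ n; have E1 : 1 <= E by rewrite exprn_ege1 // ler1n.
(* The gluing will run at scale [E * s <= u]: then [u + 2 * (E * s) <= 3 * u], and
   [2 * (u + E * s) <= 2 * g (3 * u)]. *)
pose G u := 3 * g (3 * u).
have SG : S G.
  by apply: comp_in (@scale_in 3 _) (comp_in Sg (@scale_in 3 _)); lra.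
(* From the inside: the bound [CV] of the layers of [Y], the separation [t0] of the pieces, their
   bound [D], the first scale [T] above [D] and [mu * D], one [G] per piece, and 2 for the final
   Kolmogorov rounds. *)
have SF : S (fun s => 2 * iter n.+1 G
    ((1 + mu) * hH (2 * (1 + E) * hV (L * s)))).
  apply: comp_in (@scale_in 2 _) _; first lra.
  apply: comp_in; first exact: iter_in.
  apply: comp_in (@scale_in (1 + mu) _) _; first lra.
  apply: comp_in ShH _.
  apply: comp_in (@scale_in (2 * (1 + E)) _) _; first lra.
  by apply: comp_in ShV _; exact: scale_in.
apply: (@layered_asdim_le _ _ _ _
  (Num.max M (Num.max Mg (Num.max MV MH))) dX SF) => s.
rewrite !ge_max => /and4P[Ms Mgs MVs MHs].
have s0 : 0 <= s by lra.
have Ls : s <= L * s by rewrite ler_peMl.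
have [LV [V HVs]] := HV _ (le_trans MVs Ls).
set CV := hV (L * s) in LV HVs *.
have CV0 : 0 <= CV by lra.
have ECV : CV <= E * CV by rewrite ler_peMl.
have Es : E * s <= E * CV by rewrite ler_wpM2l //; lra.
have ELs : E * (L * s) <= E * CV by rewrite ler_wpM2l //; lra.
set t0 := 2 * (1 + E) * CV.
have t0E : t0 = 2 * (CV + E * CV) by rewrite /t0; lra.
have [tD [H [HC Hcov]]] := HH t0 ltac:(lra).
set D := hH t0 in tD HC *.
have muD : 0 <= mu * D by rewrite mulr_ge0 //; lra.
set T := (1 + mu) * D.
have TE : T = D + mu * D by rewrite /T; lra.
have HG u : T <= u -> 3 * u <= g (3 * u) by move=> Tu; apply: Hg; lra.
have Gu u : T <= u -> u <= G u.
  move=> Tu; have gu := HG u Tu; have u0 : 0 <= u by lra.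
  by rewrite /G; lra.
have Es0 : 0 <= E * s by rewrite mulr_ge0 //; lra.
have T0 : 0 <= T by lra.
(* The radius is [CV] plus the [E * (L * s) <= E * CV] consumed by [n] rounds of Kolmogorov's
   trick. *)
have rt : 2 * (CV + E * CV) <= t0 by lra.
have [u y Tu|U [UC UH]] := 
  fibre_cover_glue (p := p) (k := k.+1) dX eY Es0 T0 rt HC Gu.
  have [||Q [QC Qcov]] := fib (3 * u) D y; try lra.
  exists Q; split=> // j; exists (g (3 * u)).
    by apply: chain_bounded_sub (QC j) => //; lra.
  by have := HG u Tu; rewrite /G; lra.
rewrite addn0 in UC; set Z := iter _ _ _ in UC *.
have TZ : T <= Z.
  by rewrite /Z; elim: n.+1 => //= b Tb; exact: le_trans Tb (Gu _ Tb).
have cov : fibre_cover d e p (E * s) (CV + E * (L * s)) Z k.+1 1.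
  apply: (@fibre_cover_le _ _ _ _ _ _ _ _ (CV + E * CV) _ Z) => //; first lra.
  exists U; split=> // x.
  have [i Hi] := multiplicity_pos_ex (Hcov (p x)).
  by have [j Uj] := UH _ _ Hi; exact: (@multiplicity_gt0 _ _ _ _ j).
have L0 : 0 <= L by lra.
have {}cov := fibre_cover_iter dX eY L0 pL s0 (ltn0Sn 0) cov.
have covV : layered_cover e (L * s) CV (k.+1 + n) k.+1.
  by rewrite addnC -addSnnS; exists V.
(* The multiplicities [n.+1] and [k.+1] exceed the number of layers by exactly one. *)
have mq : (k.+1 + n < 1 + n + k.+1)%N 
  by rewrite [(k.+1 + n)%N]addnC -addnA add1n.
have := layered_cover_fibration eY L0 pL cov covV mq.
rewrite addSn [(k + n)%N]addnC; apply: layered_cover_le => //.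
rewrite -/E; lra.
Qed.

End ControlSemigroup.

(** * Word length and the word metric *)

Section WordLength.
Variables (G : groupType) (A : seq G) (hA : generates A).
Local Notation len := (word_length hA).
Local Notation is_letter x := (x \in A \/ (x^-1)%g \in A).

Lemma word_length_min g n : word_of_length A g n -> (len g <= n)%N.
Proof.
by move=> gn; rewrite /word_length; case: ex_minnP => l _; apply; apply/asboolP.
Qed.

Lemma word_length_attained g : word_of_length A g (len g).
Proof. by rewrite /word_length; case: ex_minnP => l /asboolP. Qed.

Lemma word_length_ind (Q : G -> nat -> Prop) : Q 1%g 0%N ->
  (forall x g n, is_letter x -> Q g n -> Q (x * g)%g n.+1) ->
  forall g, Q g (len g).
Proof.
move=> Q1 QS g; have [w [<- + ->]] := word_length_attained g.
elim: w => [|x w IH] wA; first by rewrite big_nil.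
rewrite big_cons; apply: QS; first by apply: wA; rewrite mem_head.
by apply: IH => y yw; apply: wA; rewrite in_cons yw orbT.
Qed.

Lemma word_length1 : len 1%g = 0%N.
Proof.
by apply/eqP; rewrite -leqn0; apply: word_length_min; exists [::]; rewrite big_nil.
Qed.

Lemma word_lengthM g h : (len (g * h)%g <= len g + len h)%N.
Proof.
have [v [<- vA ->]] := word_length_attained g.
have [w [<- wA ->]] := word_length_attained h.
apply: word_length_min; exists (v ++ w); rewrite size_cat big_cat; split=> //.
by move=> x; rewrite mem_cat => /orP[/vA|/wA].
Qed.

Lemma word_length_letter x : is_letter x -> (len x <= 1)%N.
Proof.
move=> xA; apply: word_length_min; exists [:: x]; rewrite big_seq1; split=> // y.
by rewrite inE => /eqP ->.
Qed.

Lemma word_lengthV_le g : (len (g^-1)%g <= len g)%N.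
Proof.
apply: (word_length_ind (Q := fun g n => len (g^-1)%g <= n)%N).
  by rewrite invg1 word_length1.
move=> x h n xA hn; rewrite invgM -addn1.
apply: leq_trans (word_lengthM _ _) (leq_add hn _); apply: word_length_letter.
by rewrite invgK; case: xA; [right | left].
Qed.

Lemma word_lengthV g : len (g^-1)%g = len g.
Proof.
by apply/eqP; rewrite eqn_leq word_lengthV_le -{1}[g]invgK word_lengthV_le.
Qed.

Lemma letter_bounded (f : G -> nat) :
  exists c, forall x, is_letter x -> (f x <= c)%N.
Proof.
exists (\max_(x <- A ++ [seq (x^-1)%g | x <- A]) f x)%N => x xA.
apply: leq_bigmax_seq => //; rewrite mem_cat.
case: xA => [->//|xA]; apply/orP; right; apply/mapP; exists (x^-1)%g => //.
by rewrite invgK.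
Qed.

Variable R : realType.
Local Notation dist := (word_metric R hA).

Lemma word_metric_pseudometric : pseudometric dist.
Proof.
split=> [x|x y|x y z]; rewrite /word_metric.
- by rewrite mulVg word_length1.
- by rewrite -word_lengthV invgM invgK.
- rewrite -natrD ler_nat; apply: leq_trans (word_lengthM _ _).
  by rewrite -mulgA mulVKg.
Qed.

Lemma word_metric_mulg g x y : dist (g * x)%g (g * y)%g = dist x y.
Proof. by rewrite /word_metric invgM -mulgA mulKg. Qed.

End WordLength.

(** * Word length under homomorphisms *)

Section Homomorphism.
Variables (G H : groupType) (p : {multiplicative G -> H}).

Lemma multiplicative1 : p 1%g = 1%g.
Proof. by apply: (mulgI (p 1%g)); rewrite -gmulfM !mulg1. Qed.

Lemma multiplicativeV x : p (x^-1)%g = (p x)^-1%g.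
Proof.
by apply: (mulgI (p x)); rewrite -gmulfM !divgg multiplicative1.
Qed.

Variables (A : seq G) (hA : generates A) (B : seq H) (hB : generates B).

Lemma word_length_lipschitz : exists c, forall g,
  (word_length hB (p g) <= c * word_length hA g)%N.
Proof.
have [c Hc] := letter_bounded A (fun g => word_length hB (p g)).
exists c; apply: (@word_length_ind _ _ hA (fun g n => word_length hB (p g) <= c * n)%N).
  by rewrite multiplicative1 word_length1.
move=> x g n xA gn; rewrite gmulfM mulnS.
exact: leq_trans (word_lengthM _ _ _) (leq_add (Hc _ xA) gn).
Qed.

(** A shortest word is lifted letter by letter; the section [r] is no homomorphism, but only its
    values on the finitely many letters enter [c]. *)
Lemma word_length_lift : range p = setT -> exists c, forall h,
  exists2 g, p g = h & (word_length hA g <= c * word_length hB h)%N.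
Proof.
move=> pT; have /choice[r Hr] : forall h, exists g, p g = h.
  by move=> h; have [g _ <-] : range p h by [rewrite pT]; exists g.
have [c Hc] := letter_bounded B (fun h => word_length hA (r h)).
exists c; apply: (@word_length_ind _ _ hB (fun h n =>
  exists2 g, p g = h & word_length hA g <= c * n)%N).
  by exists 1%g; rewrite ?multiplicative1 // word_length1.
move=> x h n xB [g <- gn]; exists (r x * g)%g; first by rewrite gmulfM Hr.
by rewrite mulnS; exact: leq_trans (word_lengthM _ _ _) (leq_add (Hc _ xB) gn).
Qed.

End Homomorphism.

(** * Values of the asymptotic dimension, and group extensions *)

Lemma asdim_attained (R : realType) (X : Type) (d : X -> X -> R) S :
  asdim d S = +oo%E \/ exists2 n, asdim_le d S n & asdim d S = n%:R%:E.
Proof.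
case: (pselect (exists n, asdim_le d S n)) => [ex|nex]; last first.
  left; rewrite /asdim (_ : [set _ | _ in _] = set0) ?ereal_inf0 //.
  by apply/seteqP; split=> // x [n dn _]; case: nex; exists n.
right; have ex' : exists n, `[< asdim_le d S n >].
  by case: ex => n dn; exists n; apply/asboolP.
case: (ex_minnP ex') => n /asboolP dn nmin; exists n => //.
apply/eqP; rewrite eq_le; apply/andP; split.
  by apply: ereal_inf_lbound; exists n.
apply: le_ereal_inf_tmp => _ [l dl <-]; rewrite lee_fin ler_nat.
by apply: nmin; apply/asboolP.
Qed.

Lemma asdim_ge0 (R : realType) (X : Type) (d : X -> X -> R) S :
  (0 <= asdim d S)%E.
Proof. by apply: le_ereal_inf_tmp => _ [n _ <-]; rewrite lee_fin. Qed.

(** The preimage of a [D]-ball lies within [mu * D] of a coset of [K], a left translate and so an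
    isometric copy of [K]; thickened layers of [K] cover it. *)
Lemma asdim_le_extension (R : realType) (S : set (R -> R)) (K G H : groupType)
    (i : {multiplicative K -> G}) (p : {multiplicative G -> H})
    (dG : G -> G -> R) (dH : H -> H -> R) k n :
  control_semigroup S -> range i = [set g | p g = 1%g] -> range p = setT ->
  is_word_metric dG -> is_word_metric dH ->
  asdim_le (fun x y : K => dG (i x) (i y)) S k -> asdim_le dH S n ->
  asdim_le dG S (n + k).
Proof.
move=> SS ker pT [A [hA ->]] [B [hB ->]].
set dG' := word_metric R hA; set dH' := word_metric R hB.
have dG_ps : pseudometric dG' by exact: word_metric_pseudometric.
have dH_ps : pseudometric dH' by exact: word_metric_pseudometric.
set dK := fun x y : K => dG' (i x) (i y) => Kk Hn.
have dK_ps : pseudometric dK.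
  by have [d0 dC dT] := dG_ps; split=> *; rewrite /dK //.
have [c Hc] := word_length_lipschitz p hA hB.
have [mu Hmu] := word_length_lift hA hB pT.
have [f Sf [M M0 Hf]] := asdim_le_layered SS 0 dK_ps Kk.
(* [c.+1] ensures [1 <= L], and [2 * mu] makes [t / 2] a sufficient thickening. Thickening at scale
   [t] uses layers of scale [2 * t] and adds [t <= f (2 * t)] to their bound. *)
apply: (@asdim_le_fibration _ _ SS _ _ dG' dH' p c.+1%:R (2 * mu%:R) M
  (fun t => 2 * f (2 * t))) => //.
- by rewrite ler1n.
- move=> x y; rewrite /dH' /dG' /word_metric -multiplicativeV -gmulfM -natrM ler_nat.
  by apply: leq_trans (Hc _) _; rewrite leq_mul2r leqnSn orbT.
- by apply: (comp_in SS (scale_in SS _) (comp_in SS Sf (scale_in SS _))); lra.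
move=> t D y Mt Dt.
have [ft [P [PC Pcov]]] := Hf (2 * t) ltac:(lra).
have [g0 _ g0y] : range p y by rewrite pT.
have muD : mu%:R * D <= t / 2 by lra.
rewrite addn0 in P PC Pcov.
exists (fun j => [set x | exists2 u, P j u & dG' x (g0 * i u)%g <= t / 2]).
split=> [j|x xy].
  have := @chain_bounded_thicken _ _ _ dG' dK (fun u => g0 * i u)%g t (t / 2)
    (f (2 * t)) (P j) dG_ps.
  rewrite (_ : t + 2 * (t / 2) = 2 * t); last lra.
  move=> /(_ _ (PC j)) QC; apply: chain_bounded_sub (QC _) => //; first lra.
  by move=> u v; exact: word_metric_mulg.
(* [x * w] lies over [y], hence in the coset of [g0], and its distance from [x] is the length of
   [w]. *)
have [w pw wy] := Hmu ((p x)^-1 * y)%g.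
have [u _ iu] : range i (g0^-1 * x * w)%g.
  by rewrite ker /= !gmulfM multiplicativeV pw g0y -mulgA mulVKg mulVg.
have [j Pj] := multiplicity_pos_ex (Pcov u); exists j, u => //.
rewrite iu /dG' /word_metric -!mulgA mulVKg mulKg.
apply: le_trans muD; apply: le_trans (ler_wpM2l (ler0n _ _) xy).
by rewrite -natrM ler_nat.
Qed.

Theorem corollary7p11 (R : realType) (S : set (R -> R)) (K G H : groupType)
    (i : {multiplicative K -> G}) (p : {multiplicative G -> H})
    (dG : G -> G -> R) (dH : H -> H -> R) :
  control_semigroup S ->
  short_exact i p ->
  finitely_generated G ->
  is_word_metric dG ->
  is_word_metric dH ->
  (asdim dG S <= asdim (fun k l : K => dG (i k) (i l)) S + asdim dH S)%E.
Proof.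
move=> SS [_ ker pT] _ hG hH.
have [->|[k Kk ->]] := asdim_attained (fun k l : K => dG (i k) (i l)) S.
  by rewrite addye ?leey // gt_eqF // (lt_le_trans _ (asdim_ge0 _ _)).
have [->|[n Hn ->]] := asdim_attained dH S; first by rewrite addey ?leey.
rewrite -EFinD -natrD addnC; apply: ereal_inf_lbound; exists (n + k)%N => //.
exact: (asdim_le_extension SS ker pT hG hH Kk Hn).
Qed.
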